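(* Let $\mathbb F_q$ be a finite field and let $t\ge 2$ be an integer such that every prime factor of $t$ divides $q-1$. Let $\sigma=\begin{pmatrix} a&b\\ c&d\end{pmatrix}\in \mathrm{GL}_2(\mathbb F_q)$. Let $g(x)\in\mathbb F_q[x]$ be a monic irreducible polynomial of degree $n$, with $g(x)\ne x-a/c$ (no condition if $c=0$). If $q\equiv 3 \bmod 4$ and $t$ is even, assume moreover that $n$ is even. Assume that for all prime numbers $\ell\mid t$, the element $\eta(g;\sigma)$ is not an $\ell$-th power in $\mathbb F_q$. Define $g_0=g$ and $g_m=g_{m-1}^{R_{\sigma,t}}$ for $m\ge 1$. Then $(g_m)_{m\ge 0}$ is an infinite sequence of irreducible polynomials in $\mathbb F_q[x]$, with $\deg g_m=t^m\cdot n$ for all $m\geq 0$. Moreover, for every $m\ge 0$ and every $t^m$-th root of unity $\zeta\in\overline{\mathbb F}_q$, the set of roots of $g_m$ in $\overline{\mathbb F}_q$ is invariant under the Möbius action of the matrix $$M_{\sigma,\zeta}=\begin{pmatrix}\zeta ad-bc & (1-\zeta)ab\\ (\zeta-1)cd & ad-\zeta bc\end{pmatrix}\in \mathrm{GL}_2(\mathbb F_q(\zeta)),$$ and if $\zeta$ is a primitive $t^m$-th root of unity, then the class of $M_{\sigma,\zeta}$ in $\mathrm{PGL}_2(\mathbb F_q(\zeta))$ has order $t^m$.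
   Context: Let $\overline{\mathbb F}_q$ be an algebraic closure of $\mathbb F_q$. Invertible $2\times 2$ matrices over $\overline{\mathbb F}_q$ act on $\overline{\mathbb F}_q\cup\{\infty\}$ by Möbius transformations: for $\tau=\begin{pmatrix} a&b\\ c&d\end{pmatrix}$, $\tau\cdot\alpha=\frac{a\alpha+b}{c\alpha+d}$ if $c\alpha+d\neq 0$ and $\tau\cdot\alpha=\infty$ otherwise; $\tau\cdot\infty=a/c$ if $c\ne0$ and $\infty$ if $c=0$. For a nonzero polynomial $f\in\mathbb F_q[x]$ of degree $n$ and $\tau=\begin{pmatrix} a&b\\ c&d\end{pmatrix}\in \mathrm{GL}_2(\mathbb F_q)$, let $P_\tau(f)(x)=(cx+d)^n f\left(\frac{ax+b}{cx+d}\right)$, a polynomial (here $n$ is the exact degree of $f$). Let $S_t(f)(x)=f(x^t)$. For a nonzero $g\in\mathbb F_q[x]$ and $\sigma\in \mathrm{GL}_2(\mathbb F_q)$ define $g^{R_{\sigma,t}}=P_{\sigma^{-1}}(S_t(P_\sigma(g)))$. For $g$ of degree $n$ and $\sigma=\begin{pmatrix} a&b\\ c&d\end{pmatrix}$ with $g(a/c)\neq 0$ (no condition if $c=0$), define $$\eta(g;\sigma)=\left(-\frac dc\right)^n g\left(\frac bd\right) g\left(\frac ac\right)^{-1}\in\mathbb F_q,$$ with the conventions $\eta(g;\sigma)=(-d/a)^n g(b/d)$ if $c=0$, and $\eta(g;\sigma)=(-b/c)^n g(a/c)^{-1}$ if $d=0$. The element $0$ counts as an $\ell$-th power. *)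

(* Defs.v *)
From HB Require Import structures.
From mathcomp Require Import all_boot all_order all_fingroup all_algebra all_solvable all_field.

Set Implicit Arguments.
Unset Strict Implicit.
Unset Printing Implicit Defensive.

Import GRing.Theory.
Local Open Scope ring_scope.

Definition mx2 (R : Type) (a b c d : R) : 'M[R]_2 :=
  \matrix_(i < 2, j < 2)
    if i == ord0 then (if j == ord0 then a else b)
    else (if j == ord0 then c else d).

Section PolynomialTransforms.

Variable F : fieldType.
Implicit Types (tau sigma : 'M[F]_2) (f g : {poly F}).

(* (c x + d)^n * f((a x + b) / (c x + d)) with n = deg f, denominators
   cleared monomial by monomial; see mob_polyE. *)
Definition mob_poly tau f : {poly F} :=
  \sum_(i < size f)
    f`_i *: ((tau 0 0 *: 'X + (tau 0 1)%:P) ^+ i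
             * (tau 1 0 *: 'X + (tau 1 1)%:P) ^+ ((size f).-1 - i)).

Local Notation frac := (@tofrac {poly F}).

Lemma mob_polyE tau f :
  tau \in unitmx ->
  let num : {poly F} := tau 0 0 *: 'X + (tau 0 1)%:P in
  let den : {poly F} := tau 1 0 *: 'X + (tau 1 1)%:P in
  frac (mob_poly tau f)
    = frac den ^+ (size f).-1
      * (map_poly (frac \o polyC) f).[frac num / frac den].
Proof.
move=> tauU num den.
have den0 : frac den != 0.
  rewrite tofrac_eq0; apply/eqP => den0.
  have c0 : tau 1 0 = 0.
    have := congr1 (fun p : {poly F} => p`_1) den0.
    by rewrite /den !coefE /= mulr1 addr0.
  have d0 : tau 1 1 = 0.
    have := congr1 (fun p : {poly F} => p`_0) den0.
    by rewrite /den !coefE /= mulr0 add0r.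
  move: tauU; rewrite unitmxE (expand_det_row _ 1) big1 ?unitr0 // => j _.
  suff -> : tau 1 j = 0 by rewrite mul0r.
  have : (j == 0) || (j == 1) by case: j => -[|[|]].
  by case/orP=> /eqP->.
rewrite horner_coef size_map_poly mulr_sumr /mob_poly rmorph_sum /=.
apply: eq_bigr => i _.
rewrite coef_map -mul_polyC !rmorphM !rmorphXn /= exprMn exprVn.
rewrite -[in RHS](@subnK i (size f).-1); last first.
  by rewrite -ltnS (ltn_predK (ltn_ord i)).
rewrite exprD [RHS]mulrCA; congr (_ * _).
by rewrite [X in _ * _ * X]mulrC mulrA mulfK ?expf_neq0 // mulrC.
Qed.

Definition subst_pow (t : nat) f : {poly F} := f \Po 'X^t.

Definition R_transform sigma (t : nat) g : {poly F} :=
  mob_poly (invmx sigma) (subst_pow t (mob_poly sigma g)).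

Definition R_iter sigma (t : nat) g (m : nat) : {poly F} :=
  iter m (R_transform sigma t) g.

Definition eta_sigma g sigma : F :=
  let n := (size g).-1 in
  let a := sigma 0 0 in let b := sigma 0 1 in
  let c := sigma 1 0 in let d := sigma 1 1 in
  if c == 0 then (- d / a) ^+ n * g.[b / d]
  else if d == 0 then (- b / c) ^+ n * (g.[a / c])^-1
  else (- d / c) ^+ n * g.[b / d] * (g.[a / c])^-1.

End PolynomialTransforms.

(* The projective line is option L, with None the point at infinity. *)
Definition mobius (L : fieldType) (tau : 'M[L]_2) (alpha : option L) : option L :=
  let a := tau 0 0 in let b := tau 0 1 in
  let c := tau 1 0 in let d := tau 1 1 in
  match alpha with
  | Some x => if c * x + d != 0 then Some ((a * x + b) / (c * x + d)) else None
  | None => if c != 0 then Some (a / c) else None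
  end.

Definition is_root (F L : fieldType) (iota : {rmorphism F -> L})
    (f : {poly F}) (alpha : option L) : Prop :=
  if alpha is Some x then root (map_poly iota f) x else False.

Definition mobius_invariant (L : fieldType) (tau : 'M[L]_2)
    (S : option L -> Prop) : Prop :=
  forall beta, (exists2 alpha, S alpha & mobius tau alpha = beta) <-> S beta.

Definition M_mx (F L : fieldType) (iota : {rmorphism F -> L})
    (sigma : 'M[F]_2) (zeta : L) : 'M[L]_2 :=
  let a := iota (sigma 0 0) in let b := iota (sigma 0 1) in
  let c := iota (sigma 1 0) in let d := iota (sigma 1 1) in
  mx2 (zeta * (a * d) - b * c) ((1 - zeta) * (a * b))
      ((zeta - 1) * (c * d)) (a * d - zeta * (b * c)).

(* F(z) for z an N-th root of unity: subFExtend adjoins z as soon as it is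
   given a nonzero polynomial vanishing at z; it embeds in L by subfx_inj. *)
Definition adjoin_root (F : finFieldType) (L : fieldType)
    (iota : {rmorphism F -> L}) (N : nat) (z : L) : Type :=
  subFExtend iota z ('X^N - 1).

Section AdjoinRoot.

Variables (F : finFieldType) (L : fieldType) (iota : {rmorphism F -> L}).
Variables (N : nat) (z : L).

Local Notation K := (adjoin_root iota N z).
Local Notation Q := (subFExtend iota z ('X^N - 1)).

Local Open Scope quotient_scope.
Let repr_can : cancel (@generic_quotient.repr _ Q) \pi_Q := @reprK _ Q.

HB.instance Definition _ := GRing.Field.on K.
HB.instance Definition _ :=
  isCountable.Build K (pcan_pickleK (can_pcan repr_can)).
HB.instance Definition _ :=
  isFinite.Build K (pcan_enumP (can_pcan repr_can)).

Definition adjoin_root_inj : K -> L := subfx_inj (p := 'X^N - 1).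
HB.instance Definition _ := GRing.RMorphism.on adjoin_root_inj.

Lemma adjoin_rootP (N_gt0 : (0 < N)%N) (zN1 : z ^+ N = 1) (x : L) :
  (exists y, adjoin_root_inj y = x)
    <-> (exists p : {poly F}, x = (map_poly iota p).[z]).
Proof.
have nz : 'X^N - 1 != 0 :> {poly F} by rewrite -size_poly_eq0 size_XnsubC.
have rz : root (map_poly iota ('X^N - 1)) z.
  by rewrite rmorphB /= map_polyXn rmorph1 rootE !hornerE zN1 subrr.
split=> [[y <-]|[p ->]].
  by have [p ->] := subfxE y; exists p; apply: subfx_inj_eval.
by exists (subfx_eval iota z ('X^N - 1) p); apply: subfx_inj_eval.
Qed.

End AdjoinRoot.

(* Main.v *)
(* Put f = mob_poly sigma g and q = #|F|.  Since g_m is mob_poly sigma^-1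
   applied to f(x^(t^m)), and Moebius substitutions of full degree preserve
   irreducibility, everything reduces to the irreducibility of f(x^T) for
   T = t^m.  Let x be a root of f(x^T), let a = x^T and Q = q^n.  The degree of
   x over F is n s for some s, with x^(Q^s) = x.  The norm of a to F is
   eta(g; sigma), so that a^((Q-1)/l) = eta^((q-1)/l) != 1 for every prime l
   dividing T.  Hence the l-part of the order of x is the l-part of (Q-1) T,
   while it divides Q^s - 1; lifting the exponent gives T | s.

   For the invariance, M_{sigma,zeta} = sigma diag(zeta, 1) adj(sigma), and
   diag(zeta, 1) permutes the roots of f(x^T). *)

Require Import Defs.
From HB Require Import structures.
From mathcomp Require Import all_boot all_order all_fingroup all_algebra all_solvable all_field.
From mathcomp Require Import zify ring.

Set Implicit Arguments.
Unset Strict Implicit.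
Unset Printing Implicit Defensive.

Import GRing.Theory FinRing.Theory.
Local Open Scope ring_scope.

(** * Lifting the exponent *)

Section LiftingTheExponent.
Local Open Scope nat_scope.

Lemma modn_geom_sum d x s : x = 1 %[mod d] -> \sum_(i < s) x ^ i = s %[mod d].
Proof.
move=> x1; rewrite -modn_summ (eq_bigr (fun=> 1 %% d)) => [|i _].
  by rewrite modn_summ sum1_card card_ord.
by rewrite -modnXm x1 modnXm exp1n.
Qed.

Lemma modn_expn1D l y i : (1 + y * l) ^ i = 1 + i * y * l %[mod l ^ 2].
Proof.
elim: i => [|i IH]; first by rewrite expn0 mul0n.
rewrite expnS -modnMmr IH modnMmr.
have -> : (1 + y * l) * (1 + i * y * l) = i * y * y * l ^ 2 + (1 + i.+1 * y * l).
  by nia.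
by rewrite modnMDl.
Qed.

(** With [x = 1 + y * l] the sum is [l] modulo [l ^ 2], as the [i] add up to ['C(l, 2)], a multiple
    of [l] for odd [l]. For [l = 2] the sum is [1 + x], whence the condition modulo 4. *)
Lemma logn_geom_sum l x : prime l -> x = 1 %[mod l] ->
  (l = 2 -> x = 1 %[mod 4]) -> logn l (\sum_(i < l) x ^ i) = 1.
Proof.
move=> l_pr x1 x1_4; have l_gt1 := prime_gt1 l_pr.
have dv1 : l %| \sum_(i < l) x ^ i by rewrite /dvdn modn_geom_sum // modnn.
have S_gt0 : 0 < \sum_(i < l) x ^ i.
  by case: (l) l_gt1 => // k _; rewrite big_ord_recl expn0.
suff ndv2 : ~~ (l ^ 2 %| \sum_(i < l) x ^ i).
  apply/eqP; rewrite eqn_leq -(pfactor_dvdn 1) // dv1 andbT.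
  by rewrite leqNgt -pfactor_dvdn.
have ll2 : l %% l ^ 2 = l by rewrite modn_small // -{1}(expn1 l) ltn_exp2l.
suff S_l : \sum_(i < l) x ^ i = l %[mod l ^ 2].
  by rewrite /dvdn S_l ll2 -lt0n prime_gt0.
have [l2|l_odd] := even_prime l_pr; first by rewrite l2 modn_geom_sum // x1_4.
have [y ->] : exists y, x = 1 + y * l.
  exists (x %/ l); rewrite {1}(divn_eq x l) x1 modn_small //; lia.
rewrite -modn_summ; under eq_bigr do rewrite modn_expn1D.
rewrite modn_summ big_split /= sum1_card card_ord.
have -> : \sum_(i < l) i * y * l = (\sum_(i < l) i) * y * l.
  by rewrite !big_distrl.
rewrite -(big_mkord xpredT id) bin2_sum.
have /dvdnP[k ->] : l %| 'C(l, 2).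
  by apply: prime_dvd_bin => //; move: l_odd l_gt1; case: (l) => [|[|[]]].
have -> : l + k * l * y * l = k * y * l ^ 2 + l by nia.
by rewrite modnMDl.
Qed.

(** Factors [l] of [s] are removed one at a time, each adding one by [logn_geom_sum]. Once [l] does
    not divide [s], the geometric sum is [s] modulo [l], hence prime to [l]. *)
Lemma logn_expn_pred l x s : prime l -> 1 < x -> x = 1 %[mod l] ->
    (l = 2 -> x = 1 %[mod 4]) -> 0 < s ->
  logn l (x ^ s).-1 = logn l x.-1 + logn l s.
Proof.
move=> l_pr x_gt1 x1 x1_4; elim/ltn_ind: s => s IH s_gt0.
have pow1 d k : x = 1 %[mod d] -> x ^ k = 1 %[mod d].
  by move=> e; rewrite -modnXm e modnXm exp1n.
have pred_gt0 k : 0 < k -> 0 < (x ^ k).-1.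
  by move=> k_gt0; rewrite -subn1 subn_gt0 -(expn0 x) ltn_exp2l.
have [/dvdnP[s' def_s]|ndv] := boolP (l %| s); last first.
  have S_mod := modn_geom_sum s x1.
  rewrite predn_exp lognM; [| by rewrite -(expn1 x) pred_gt0 |]; last first.
    by have := pred_gt0 _ s_gt0; rewrite predn_exp muln_gt0 => /andP[].
  congr (_ + _).
  have lp n : ~~ (l %| n) -> logn l n = 0.
    by move=> ln; rewrite lognE l_pr (negPf ln) andbF.
  by rewrite !lp // /dvdn S_mod.
have l_gt1 := prime_gt1 l_pr.
have s'_gt0 : 0 < s' by case: (s') def_s s_gt0 => // ->.
have s'_lt : s' < s by rewrite def_s ltn_Pmulr.
have S1 : logn l (\sum_(i < l) (x ^ s') ^ i) = 1.
  by apply: logn_geom_sum => //; [apply: pow1 | move=> l2; apply/pow1/x1_4].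
have S_gt0 : 0 < \sum_(i < l) (x ^ s') ^ i.
  by case: (\sum_(i < l) _) S1 => //; rewrite logn0.
rewrite {1}def_s expnM predn_exp lognM ?pred_gt0 // S1 IH //.
by rewrite [in RHS]def_s lognM ?(ltnW l_gt1) // (logn_prime l l_pr) eqxx addnA.
Qed.

End LiftingTheExponent.

(** * Roots of irreducible polynomials over a finite field *)

Section FiniteFieldRoots.

Variables (F : finFieldType) (L : closedFieldType) (iota : {rmorphism F -> L}).
Local Notation q := #|F|.
Local Notation "p ^i" := (map_poly iota p) (at level 2, format "p ^i").
Implicit Types (f g p : {poly F}) (x y : L).

Lemma expf_card_pow (c : F) k : c ^+ (q ^ k) = c.
Proof. by elim: k => // k IH; rewrite expnS exprM expf_card. Qed.

Lemma exprD_card k x y : (x + y) ^+ (q ^ k) = x ^+ (q ^ k) + y ^+ (q ^ k).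
Proof.
apply: exprDn_pchar; have [p p_pr pF] := finPcharP F.
(* [q] is a power of the characteristic: the additive group of [F] is an elementary abelian
   p-group. *)
rewrite (eq_pnat _ (pcharf_eq (rmorph_pchar iota pF))) pnatX -cardsT.
by rewrite [_.-nat _](abelem_pgroup (fin_ring_pchar_abelem pF)).
Qed.

Lemma horner_frobenius p k x : p^i.[x] ^+ (q ^ k) = p^i.[x ^+ (q ^ k)].
Proof.
elim/poly_ind: p => [|p c IH].
  have q_gt0 := ltnW (finNzRing_gt1 F).
  by rewrite rmorph0 !horner0 expr0n expn_eq0 (gtn_eqF q_gt0).
rewrite rmorphD rmorphM /= map_polyX map_polyC !hornerE exprD_card exprMn IH.
by rewrite -rmorphXn expf_card_pow.
Qed.

Lemma irredp_common_root f p x : irreducible_poly f ->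
  root f^i x -> root p^i x -> f %| p.
Proof.
move=> f_irr fx px; have := irreducible_poly_coprime p f_irr.
case: (f %| p) => //=; rewrite -(coprimep_map iota) => /coprimep_root/(_ fx).
by rewrite -rootE px.
Qed.

(** In the field [F[X]/(f)] with [q ^ n] elements, the class of [X] is fixed by the [q ^ n]-th
    power, so [f] divides ['X^(q ^ n) - 'X]. *)
Lemma irredp_root_frobenius f n x : irreducible_poly f -> size f = n.+1 ->
  root f^i x -> x ^+ (q ^ n) = x.
Proof.
move=> f_irr f_size fx.
have lf0 : lead_coef f != 0 by rewrite lead_coef_eq0 irredp_neq0.
pose h := (lead_coef f)^-1 *: f.
have hf : h %= f by rewrite eqp_scale ?invr_eq0.
have h_monic : h \is monic by rewrite monicE lead_coefZ mulVf.
have h_irr : irreducible_poly h.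
  split=> [|p p_size]; first by rewrite (eqp_size hf) f_irr.1.
  rewrite (eqp_dvdr _ hf) => /(apply_irredp f_irr p_size) pf.
  by rewrite (eqp_trans pf) // eqp_sym.
pose hI : monic_irreducible_poly h := (h_irr, h_monic).
have : in_qpoly h 'X ^+ (q ^ n) = in_qpoly h 'X :> {poly %/ h with hI}.
  have <- : #|{poly %/ h with hI}| = (q ^ n)%N.
    by rewrite card_qfpoly (eqp_size hf) f_size.
  exact: expf_card.
have mh : mk_monic h = h by rewrite mk_monicE.
rewrite -[_ ^+ _](rmorphXn (in_qpoly h)) => /(congr1 val) /= /eqP.
rewrite -subr_eq0 mh -Pdiv.RingMonic.rmodpB // => h_dvd.
have : f %| 'X^(q ^ n) - 'X by rewrite -(eqp_dvdl _ hf) dvdpE.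
rewrite -(dvdp_map iota) rmorphB /= map_polyXn map_polyX => /dvdpP[r def_r].
apply/eqP; rewrite -subr_eq0; move: (congr1 (horner^~ x) def_r).
by rewrite !hornerE (rootP fx) mulr0 => ->.
Qed.

(* Frobenius^k fixes F(x), which has at least q^n elements, all of them roots
   of X^(q^k) - X. *)
Lemma irredp_root_degree f n k x : irreducible_poly f -> size f = n.+1 ->
  root f^i x -> (0 < k)%N -> x ^+ (q ^ k) = x -> (n <= k)%N.
Proof.
move=> f_irr f_size fx k_gt0 xk.
pose v (r : {poly_n F}) := (r : {poly F})^i.[x].
have v_inj : injective v.
  move=> r s /eqP.
  rewrite -subr_eq0 -hornerN -hornerD -rmorphN -rmorphD /= => rs0.
  have f_rs := irredp_common_root f_irr fx rs0; apply/val_inj/eqP.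
  rewrite -subr_eq0; apply: contraTT f_rs => rs_neq0.
  rewrite gtNdvdp // f_size ltnS (leq_trans (size_polyD _ _)) //.
  by rewrite size_polyN geq_max !size_npoly.
pose P : {poly L} := 'X^(q ^ k) - 'X.
have qk_gt1 : (1 < q ^ k)%N by rewrite -(expn0 q) ltn_exp2l ?finNzRing_gt1.
have P_size : size P = (q ^ k).+1.
  by rewrite size_polyDl size_polyXn // size_polyN size_polyX ltnS.
have P_neq0 : P != 0 by rewrite -size_poly_gt0 P_size.
have : (size (codom v) < size P)%N.
  apply: max_poly_roots => //; last by rewrite map_inj_uniq ?enum_uniq.
  apply/allP => _ /codomP[r ->]; rewrite rootE !hornerE.
  by rewrite horner_frobenius xk subrr.
by rewrite size_codom card_npoly P_size ltnS leq_exp2l ?finNzRing_gt1.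
Qed.

(** The remainder [k %% n] inherits the fixed-point equation; were it positive, [irredp_root_degree]
    would make it at least [n]. *)
Lemma irredp_root_dvd f n k x : irreducible_poly f -> size f = n.+1 ->
  root f^i x -> x ^+ (q ^ k) = x -> (n %| k)%N.
Proof.
move=> f_irr f_size fx xk.
have xn := irredp_root_frobenius f_irr f_size fx.
have n_gt0 : (0 < n)%N by have := f_irr.1; rewrite f_size.
have xnj j : x ^+ (q ^ (j * n)) = x.
  by elim: j => // j IH; rewrite mulSn expnD exprM xn.
rewrite /dvdn -leqn0 leqNgt; apply/negP => r_gt0.
suff: (n <= k %% n)%N by rewrite leqNgt ltn_pmod.
apply: irredp_root_degree f_irr f_size fx r_gt0 _.
by rewrite -[RHS]xk [in RHS](divn_eq k n) expnD exprM xnj.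
Qed.

Hypothesis Lalg : forall x, algebraicOver iota x.

Lemma irredp_of_root x : exists2 f, irreducible_poly f & root f^i x.
Proof.
have dec : decidable_embedding iota.
  move=> y; have [c /eqP->|no] := pickP (fun c => y == iota c).
    by left; exists c.
  by right => -[c /eqP]; rewrite no.
have x_int := proj1 (integral_algebraic iota x) (Lalg x).
have [f [_ fx f_irr]] := minPoly_decidable_closure dec x_int.
by exists f.
Qed.

(** A root of a nonconstant divisor [h] has an irreducible polynomial [f] dividing [h]. The
    hypothesis with [k = deg f] gives [deg p <= deg f <= deg h]. *)
Lemma irredp_criterion p : (1 < size p)%N ->
    (forall x k, root p^i x -> (0 < k)%N -> x ^+ (q ^ k) = x ->
       (size p <= k.+1)%N) ->
  irreducible_poly p.
Proof.
move=> p_size p_roots; split=> // h h_size h_dvd.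
have p_neq0 : p != 0 by rewrite -size_poly_gt0 ltnW.
have [x hx] : exists x, root h^i x.
  by apply/closed_rootP; rewrite size_map_poly.
have [f f_irr fx] := irredp_of_root x.
have fh : f %| h by apply: irredp_common_root fx hx.
have f_gt1 := f_irr.1; rewrite -dvdp_size_eqp // eqn_leq dvdp_leq //=.
have f_size : size f = (size f).-1.+1 by case: (size f) f_gt1.
apply: (@leq_trans (size f)).
  rewrite f_size; apply: (p_roots x); last exact: irredp_root_frobenius fx.
    by move: (dvdp_map iota h p) h_dvd => <- /dvdpP[r ->]; rewrite rootM hx orbT.
  by case: (size f) f_gt1 => [|[]].
by rewrite dvdp_leq // (dvdpN0 h_dvd).
Qed.

End FiniteFieldRoots.
(** * Irreducibility of f(x^T) *)

Lemma prime_power_dvd_exponent (R : nzRingType) (x : R) l k N : prime l ->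
    x ^+ (l ^ k.+1) = 1 -> x ^+ (l ^ k) != 1 -> x ^+ N = 1 ->
  (l ^ k.+1 %| N)%N.
Proof.
move=> l_pr xl1 xl xN.
have [m x_m] : {m | m.-primitive_root x & (m %| l ^ k.+1)%N}.
  by apply: prim_order_exists; rewrite ?expn_gt0 ?prime_gt0.
case/(dvdn_pfactor _ _ l_pr) => j; rewrite leq_eqVlt => /orP[/eqP->|jk] mj.
  by rewrite -mj (prim_order_dvd x_m) xN.
by move: xl; rewrite -(prim_order_dvd x_m) mj dvdn_exp2l.
Qed.

(** For each prime [l] dividing [T], with [w] and [v + 1] the valuations of [T] and [Q - 1], a power
    of [x] has order [l ^ (w + v + 1)]. This order divides [Q ^ s - 1], of valuation [v + 1] plus
    that of [s], so [l ^ w] divides [s]. *)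
Lemma root_degree_dvd (K : fieldType) (x : K) Q s T :
    (1 < Q)%N -> (0 < s)%N -> (0 < T)%N -> x != 0 ->
    (forall l, prime l -> (l %| T)%N -> Q = 1 %[mod l]) ->
    (~~ odd T -> Q = 1 %[mod 4]) ->
    x ^+ (Q ^ s) = x -> x ^+ T ^+ Q = x ^+ T ->
    (forall l, prime l -> (l %| T)%N -> x ^+ T ^+ (Q.-1 %/ l) != 1) ->
  (T %| s)%N.
Proof.
move=> Q_gt1 s_gt0 T_gt0 x_neq0 Ql Q4 xQs xTQ xTl.
have unexp (y : K) m : y != 0 -> (0 < m)%N -> y ^+ m = y -> y ^+ m.-1 = 1.
  move=> y_neq0 m_gt0 ym; apply: (mulfI y_neq0).
  by rewrite -exprS prednK // mulr1.
apply/(dvdn_partP _ T_gt0) => l; rewrite mem_primes => /and3P[l_pr _ lT].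
rewrite p_part; set w := logn l T.
have Q1_gt0 : (0 < Q.-1)%N by rewrite -subn1 subn_gt0.
have lQ : (l %| Q.-1)%N by rewrite -subn1 -eqn_mod_dvd ?(ltnW Q_gt1) // Ql.
have [v def_v] : exists v, logn l Q.-1 = v.+1.
  have : (0 < logn l Q.-1)%N by rewrite logn_gt0 mem_primes l_pr Q1_gt0.
  by case: logn => // v; exists v.
have lnQs : logn l (Q ^ s).-1 = (v.+1 + logn l s)%N.
  have Q4' : l = 2%N -> Q = 1 %[mod 4].
    by move=> l2; apply: Q4; rewrite -dvdn2 -l2.
  by rewrite (logn_expn_pred l_pr Q_gt1 (Ql l l_pr lT) Q4' s_gt0) def_v.
rewrite pfactor_dvdn // -(leq_add2l v.+1) -lnQs -pfactor_dvdn //; last first.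
  by rewrite -subn1 subn_gt0 -(expn0 Q) ltn_exp2l.
(* y has order exactly l^(w + v + 1). *)
pose y := x ^+ (T %/ l ^ w * (Q.-1 %/ l ^ v.+1)).
have y_exp j : y ^+ (l ^ (w + j)) = x ^+ T ^+ (Q.-1 %/ l ^ v.+1 * l ^ j).
  rewrite -!exprM expnD mulnACA divnK ?pfactor_dvdnn //.
have ldvd : (l ^ v.+1 %| Q.-1)%N by rewrite -def_v pfactor_dvdnn.
rewrite addSn; apply: (@prime_power_dvd_exponent _ y) => //.
- rewrite -addSn addnC y_exp divnK //.
  by apply: unexp; rewrite ?expf_neq0 // ltnW.
- rewrite addnC y_exp.
  have -> : (Q.-1 %/ l ^ v.+1 * l ^ v = Q.-1 %/ l)%N.
    have /dvdnP[c ->] := ldvd.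
    rewrite mulnK ?expn_gt0 ?prime_gt0 // expnSr mulnA mulnK ?prime_gt0 //.
  exact: xTl.
by rewrite -exprM mulnC exprM unexp ?expr1n // expn_gt0 ltnW.
Qed.

(** In terms of a generator [u] of the cyclic unit group, [c = u ^ k], and the hypothesis makes
    [q - 1] divide [k (q - 1) / l], so [l] divides [k]. *)
Lemma finField_power (F : finFieldType) (c : F) l : (0 < l)%N ->
  (l %| #|F| - 1)%N -> c ^+ (#|F|.-1 %/ l) = 1 -> exists y, c = y ^+ l.
Proof.
rewrite subn1 => l_gt0 l_dvd c1.
have q1_gt0 : (0 < #|F|.-1)%N by rewrite -subn1 subn_gt0 finNzRing_gt1.
have e_gt0 : (0 < #|F|.-1 %/ l)%N by rewrite divn_gt0 // dvdn_leq.
have c_neq0 : c != 0.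
  apply: contra_eq_neq c1 => ->.
  by rewrite expr0n (gtn_eqF e_gt0) eq_sym oner_neq0.
have /cyclicP[u def_u] := field_unit_group_cyclic [set: {unit F}].
have u_ord : #[u]%g = #|F|.-1 by rewrite orderE -def_u card_finField_unit.
have : finField_unit c_neq0 \in <[u]>%g by rewrite -def_u inE.
case/cycleP => k cu.
have := c1; rewrite -[c]/(val (finField_unit c_neq0)) cu -val_unitX.
rewrite -val_unit1 => /val_inj/eqP; rewrite -expgM -order_dvdn u_ord.
rewrite -{1}(divnK l_dvd) mulnC dvdn_pmul2r // => /dvdnP[j def_k].
by exists (val (u ^+ j)%g); rewrite -val_unitX -expgM -def_k -cu.
Qed.

Lemma size_comp_Xn (R : idomainType) (p : {poly R}) n T :
  size p = n.+1 -> (0 < T)%N -> size (p \Po 'X^T) = (n * T).+1.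
Proof.
move=> p_size T_gt0.
have := size_comp_poly p 'X^T; rewrite size_polyXn p_size /= => <-.
rewrite prednK // size_poly_gt0 comp_poly_eq0 -?size_poly_gt0 ?p_size //.
by rewrite size_polyXn ltnS.
Qed.

Section PowerSubstitution.

Variables (F : finFieldType) (L : closedFieldType) (iota : {rmorphism F -> L}).
Local Notation q := #|F|.
Local Notation "p ^i" := (map_poly iota p) (at level 2, format "p ^i").
Implicit Types (f g p : {poly F}) (x y : L).

(** The left side is the norm of [x], the product of its conjugates [x ^+ (q ^ i)]. These are [n]
    distinct roots of [f], hence all of them, and evaluating the factorization at 0 gives the
    value. *)
Lemma irredp_root_norm f n x : irreducible_poly f -> size f = n.+1 ->
  root f^i x ->
  x ^+ (\sum_(i < n) q ^ i) = iota ((-1) ^+ n * f`_0 / f`_n).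
Proof.
move=> f_irr f_size fx.
have xn := irredp_root_frobenius f_irr f_size fx.
pose rs := [seq x ^+ (q ^ i) | i <- index_iota 0 n].
have rs_uniq : uniq rs.
  rewrite map_inj_in_uniq ?iota_uniq // => i j.
  wlog ij : i j / (i <= j)%N.
    by move=> W; have [/W//|/ltnW/W{}W hi hj /esym/W->] := leqP i j.
  rewrite !mem_iota !add0n !subn0 /= => i_n j_n xij.
  (* Both sides of [xij] are raised to the power [q ^ (n - i)], which turns the left one into
     [x]. *)
  have : x ^+ (q ^ (j - i)) = x.
    rewrite -[RHS]xn -(subnK (ltnW i_n)) addnC expnD exprM xij -exprM -expnD.
    have -> : (j + (n - i) = n + (j - i))%N by lia.
    by rewrite expnD exprM xn.
  move/(irredp_root_dvd f_irr f_size fx); rewrite /dvdn modn_small; last by lia.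
  by lia.
have fn : lead_coef f^i = iota f`_n by rewrite lead_coef_map lead_coefE f_size.
have fn_neq0 : f`_n != 0.
  by rewrite -[n]/(n.+1.-1) -f_size -lead_coefE lead_coef_eq0 irredp_neq0.
have : f^i = lead_coef f^i *: \prod_(z <- rs) ('X - z%:P).
  apply: all_roots_prod_XsubC; rewrite ?uniq_rootsE //.
    by rewrite size_map_poly f_size size_map size_iota subn0.
  apply/allP => _ /mapP[i _ ->].
  have q_gt0 := ltnW (finNzRing_gt1 F).
  by rewrite rootE -horner_frobenius (rootP fx) expr0n expn_eq0 (gtn_eqF q_gt0).
move/(congr1 (horner^~ 0)); rewrite horner_coef0 coef_map hornerZ fn horner_prod.
rewrite big_map big_mkord; under eq_bigr do rewrite hornerXsubC sub0r.
rewrite prodrN card_ord => f0.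
rewrite (big_morph (fun k => x ^+ k) (exprD x) (expr0 x)) fmorph_div rmorphM.
by rewrite rmorph_sign /= f0 mulrCA signrMK mulrC mulKf ?fmorph_eq0.
Qed.

(** If a root [x] satisfies [x ^+ (q ^ k) = x], then [k = s * n] because [x ^+ T] is a root of [f].
    Then [root_degree_dvd] with [Q = q ^ n] gives [T %| s], so [k] is at least [n * T]. *)
Lemma irredp_comp_Xn f n T : (forall x, algebraicOver iota x) ->
    irreducible_poly f -> size f = n.+1 -> (0 < T)%N ->
    (forall l, prime l -> (l %| T)%N -> (l %| q - 1)%N) ->
    (~~ odd T -> q ^ n = 1 %[mod 4])%N ->
    (forall l, prime l -> (l %| T)%N ->
       ~ exists c, (-1) ^+ n * f`_0 / f`_n = c ^+ l) ->
    f`_0 != 0 ->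
  irreducible_poly (f \Po 'X^T).
Proof.
move=> Lalg f_irr f_size T_gt0 T_primes T4 f_npow f0_neq0.
have n_gt0 : (0 < n)%N by have := f_irr.1; rewrite f_size.
have h_size := size_comp_Xn f_size T_gt0.
apply: (irredp_criterion Lalg); first by rewrite h_size ltnS muln_gt0 n_gt0.
move=> x k hx k_gt0 xk; rewrite h_size ltnS.
have fxT : root f^i (x ^+ T).
  by move: hx; rewrite rootE map_comp_poly horner_comp map_polyXn hornerXn.
have x_neq0 : x != 0.
  apply: contraNneq f0_neq0 => x0; move: fxT; rewrite x0 expr0n (gtn_eqF T_gt0).
  by rewrite rootE horner_coef0 coef_map fmorph_eq0.
have /dvdnP[s def_k] : (n %| k)%N.
  by apply: (irredp_root_dvd f_irr f_size fxT); rewrite -exprM mulnC exprM xk.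
have s_gt0 : (0 < s)%N by move: k_gt0; rewrite def_k muln_gt0 => /andP[].
rewrite def_k mulnC leq_pmul2r // dvdn_leq //.
have q_gt1 := finNzRing_gt1 F.
have q_mod l : prime l -> (l %| T)%N -> q = 1 %[mod l].
  by move=> l_pr lT; apply/eqP; rewrite eqn_mod_dvd ?T_primes // ltnW.
apply: (@root_degree_dvd _ x (q ^ n)) => //.
- by rewrite -(expn0 q) ltn_exp2l.
- by move=> l l_pr lT; rewrite -modnXm q_mod // modnXm exp1n.
- by rewrite -expnM mulnC -def_k.
- exact: irredp_root_frobenius fxT.
(* As [q ^ n - 1] is [q - 1] times [1 + q + ... + q ^ (n - 1)], the assumption [xTl] says that the
   norm of [x ^+ T] has [(q - 1) / l]-th power 1, which makes it an [l]-th power. *)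
move=> l l_pr lT; apply/eqP => xTl; apply: (f_npow l l_pr lT).
apply: finField_power; rewrite ?prime_gt0 ?T_primes //.
apply: (fmorph_inj iota); rewrite rmorph1 rmorphXn.
rewrite -(irredp_root_norm f_irr f_size fxT).
rewrite -[LHS]exprM -[RHS]xTl predn_exp; congr (_ ^+ _).
by rewrite mulnC divn_mulAC // -subn1 T_primes.
Qed.

End PowerSubstitution.
(** * Moebius substitutions *)

Section HomogeneousEvaluation.

Variable K : fieldType.
Implicit Types (p : {poly K}) (s : 'M[K]_2) (v : K * K).

(* The homogenization of p in degree N: unlike p.[x / y], it makes sense at the
   point at infinity y = 0. *)
Definition homog_eval N p v : K :=
  \sum_(i < N.+1) p`_i * (v.1 ^+ i * v.2 ^+ (N - i)).

Definition mx2_act s v : K * K :=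
  (s 0 0 * v.1 + s 0 1 * v.2, s 1 0 * v.1 + s 1 1 * v.2).

Lemma mulmx2E s s' i j : (s *m s') i j = s i 0 * s' 0 j + s i 1 * s' 1 j.
Proof.
rewrite mxE !big_ord_recl big_ord0 addr0.
by congr (_ * _ + s _ _ * s' _ _); apply/val_inj.
Qed.

Lemma mx2_actM s s' v : mx2_act (s *m s') v = mx2_act s (mx2_act s' v).
Proof. by rewrite /mx2_act !mulmx2E /=; congr pair; ring. Qed.

Lemma mx2_act1 v : mx2_act 1%:M v = v.
Proof.
by case: v => x y; rewrite /mx2_act !mxE /= !mul1r !mul0r addr0 add0r.
Qed.

Lemma mx2_act_neq0 s v : s \in unitmx -> v != 0 -> mx2_act s v != 0.
Proof.
move=> sU; apply: contraNneq => sv0.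
rewrite -[v]mx2_act1 -(mulVmx sU) mx2_actM sv0.
by rewrite /mx2_act /= !mulr0 addr0.
Qed.

Lemma homog_eval1 N p x : size p = N.+1 -> homog_eval N p (x, 1) = p.[x].
Proof.
move=> p_size; rewrite horner_coef p_size; apply: eq_bigr => i _.
by rewrite expr1n mulr1.
Qed.

Lemma homog_evalZ N p z v :
  homog_eval N p (z * v.1, z * v.2) = z ^+ N * homog_eval N p v.
Proof.
rewrite mulr_sumr; apply: eq_bigr => i _ /=.
rewrite !exprMn_comm; [|exact: mulrC..].
have <- : z ^+ i * z ^+ (N - i) = z ^+ N by rewrite -exprD subnKC // -ltnS.
ring.
Qed.

Lemma homog_eval_infty N p x : homog_eval N p (x, 0) = p`_N * x ^+ N.
Proof.
rewrite /homog_eval (bigD1 ord_max) //= subnn expr0 mulr1.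
rewrite big1 ?addr0 // => i iN.
rewrite expr0n subn_eq0 leqNgt.
have -> : (i < N)%N by rewrite ltn_neqAle -ltnS ltn_ord andbT.
by rewrite !mulr0.
Qed.

Lemma homog_eval_div N p v : size p = N.+1 -> v.2 != 0 ->
  homog_eval N p v = v.2 ^+ N * p.[v.1 / v.2].
Proof.
move=> p_size v2; rewrite -(homog_eval1 _ p_size) -homog_evalZ /=.
by congr homog_eval; case: v v2 => x y /= y0; rewrite mulr1 mulrC divfK.
Qed.

(** At infinity the value is the leading coefficient times [v.1 ^+ N], so a polynomial of exact
    degree [N] has only affine zeros. *)
Lemma homog_eval_root N p v : size p = N.+1 -> v != 0 ->
  homog_eval N p v = 0 -> v.2 != 0 /\ root p (v.1 / v.2).
Proof.
move=> p_size v_neq0 pv0; have [v2|v2] := eqVneq v.2 0.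
  case/eqP: v_neq0; move: pv0; case: v v2 => x y /= ->.
  move/eqP; rewrite homog_eval_infty mulf_eq0 -[N]/(N.+1.-1) -p_size.
  rewrite -lead_coefE lead_coef_eq0 -size_poly_eq0 p_size /=.
  by rewrite expf_eq0 => /andP[_ /eqP->].
split=> //; move/eqP: pv0.
by rewrite homog_eval_div // mulf_eq0 expf_eq0 (negPf v2) andbF.
Qed.

Lemma horner_mob_poly N s p x : size p = N.+1 ->
  (mob_poly s p).[x] = homog_eval N p (mx2_act s (x, 1)).
Proof.
move=> p_size; rewrite /mob_poly p_size horner_sum; apply: eq_bigr => i _.
by rewrite !hornerE /= !mulr1.
Qed.

Lemma size_lin_exp (a b : K) i : (size ((a *: 'X + b%:P) ^+ i) <= i.+1)%N.
Proof.
apply: leq_trans (size_poly_exp_leq _ _) _; rewrite ltnS.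
apply: leq_trans (leq_mul _ (leqnn i)) (eq_leq (mul1n i)).
rewrite -subn1 leq_subLR (leq_trans (size_polyD _ _)) // geq_max.
rewrite (leq_trans (size_scale_leq _ _)) ?size_polyX //=.
by rewrite (leq_trans (size_polyC_leq1 _)).
Qed.

Lemma coefM_top p p' i j : (size p <= i.+1)%N -> (size p' <= j.+1)%N ->
  (p * p')`_(i + j) = p`_i * p'`_j.
Proof.
move=> pi pj; rewrite coefM.
have li : (i < (i + j).+1)%N by rewrite ltnS leq_addr.
rewrite (bigD1 (Ordinal li)) //= addKn big1 ?addr0 // => k.
rewrite -val_eqE /= neq_ltn => /orP[ki|ik].
  by rewrite [X in _ * X]nth_default ?mulr0 // (leq_trans pj) //; lia.
by rewrite nth_default ?mul0r // (leq_trans pi).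
Qed.

Lemma coef_lin_exp (a b : K) i : ((a *: 'X + b%:P) ^+ i)`_i = a ^+ i.
Proof.
elim: i => [|i IH]; first by rewrite coef1.
rewrite !exprS -add1n coefM_top ?size_lin_exp ?IH //.
  by rewrite coefD coefZ coefX coefC mulr1 addr0.
exact: (size_lin_exp _ _ 1).
Qed.

Lemma size_mob_poly_leq s p : (size (mob_poly s p) <= size p)%N.
Proof.
apply: (big_ind (fun r : {poly K} => (size r <= size p)%N)).
- by rewrite size_poly0.
- by move=> r r' hr hr'; rewrite (leq_trans (size_polyD _ _)) // geq_max hr.
move=> i _; apply: leq_trans (size_scale_leq _ _) _.
apply: leq_trans (size_polyMleq _ _) _.
have := size_lin_exp (s 0 0) (s 0 1) i.
have := size_lin_exp (s 1 0) (s 1 1) ((size p).-1 - i).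
by have := ltn_ord i; lia.
Qed.

(** The pair [(s 0 0, s 1 0)] is the image of the point at infinity [(1, 0)]; the degree drops
    exactly when [p] vanishes there. *)
Lemma coef_mob_poly N s p : size p = N.+1 ->
  (mob_poly s p)`_N = homog_eval N p (s 0 0, s 1 0).
Proof.
move=> p_size; rewrite /mob_poly p_size coef_sum; apply: eq_bigr => i _.
have iN : (i <= N)%N by rewrite -ltnS.
rewrite coefZ; congr (_ * _).
rewrite -[X in _`_X](subnKC iN) coefM_top ?size_lin_exp //.
by rewrite !coef_lin_exp.
Qed.

Lemma size_mob_poly N s p : size p = N.+1 ->
  homog_eval N p (s 0 0, s 1 0) != 0 -> size (mob_poly s p) = N.+1.
Proof.
move=> p_size; rewrite -(coef_mob_poly _ p_size) => pN.
apply/eqP; rewrite eqn_leq -{1}p_size size_mob_poly_leq /= ltnNge.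
by apply: contra pN => /leq_sizeP->.
Qed.

(** Affine points reduce to [horner_mob_poly]. At infinity only the coefficient of degree [N]
    remains, and [coef_mob_poly] applies. *)
Lemma homog_eval_mob N s p v : size p = N.+1 -> size (mob_poly s p) = N.+1 ->
  homog_eval N (mob_poly s p) v = homog_eval N p (mx2_act s v).
Proof.
move=> p_size m_size; have [v2|v2] := eqVneq v.2 0.
  case: v v2 => x y /= ->.
  rewrite homog_eval_infty coef_mob_poly // mulrC -homog_evalZ /mx2_act /=.
  by rewrite !mulr0 !addr0; congr homog_eval; congr pair; rewrite mulrC.
rewrite homog_eval_div // (horner_mob_poly _ _ p_size) -homog_evalZ.
rewrite /mx2_act /=; congr homog_eval.
by congr pair; field.
Qed.

Lemma homog_eval_comp_Xn T n p z v : (0 < T)%N -> size p = n.+1 -> z ^+ T = 1 ->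
  homog_eval (n * T) (p \Po 'X^T) (z * v.1, v.2)
    = homog_eval (n * T) (p \Po 'X^T) v.
Proof.
move=> T_gt0 p_size zT; apply: eq_bigr => i _; rewrite coef_comp_poly_Xn //=.
case: dvdnP => [[k ->]|_]; last by rewrite !mul0r.
by rewrite exprMn (_ : z ^+ (k * T) = 1) ?mul1r // mulnC exprM zT expr1n.
Qed.

End HomogeneousEvaluation.
Section MobiusAction.

Variable K : fieldType.
Implicit Types (p : {poly K}) (s : 'M[K]_2) (x : K).

Lemma det_mx2E s : \det s = s 0 0 * s 1 1 - s 0 1 * s 1 0.
Proof.
rewrite (expand_det_row _ 0) !big_ord_recl big_ord0 /cofactor !det_mx11 !mxE.
have -> : lift ord0 (0 : 'I_1) = 1 :> 'I_2 by apply/val_inj.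
have -> : lift (1 : 'I_2) (0 : 'I_1) = 0 :> 'I_2 by apply/val_inj.
by rewrite /= expr0 expr1; ring.
Qed.

(** Homogeneous evaluation merges the three cases of [eta_sigma]: when [c = 0] or [d = 0], the value
    at infinity is a pure power since [g] is monic. *)
Lemma eta_sigmaE (g : {poly K}) n s :
    s \in unitmx -> g \is monic -> size g = n.+1 ->
  eta_sigma g s = (-1) ^+ n * homog_eval n g (s 0 1, s 1 1)
                  / homog_eval n g (s 0 0, s 1 0).
Proof.
rewrite unitmxE unitfE det_mx2E => det_neq0 g_monic g_size.
have gn : g`_n = 1 by move/monicP: g_monic; rewrite lead_coefE g_size.
rewrite /eta_sigma g_size /=; move: det_neq0.
have [-> | c0] := eqVneq (s 1 0) 0.
  rewrite mulr0 subr0 mulf_eq0 negb_or => /andP[a0 d0].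
  rewrite homog_eval_infty gn mul1r (homog_eval_div g_size) //=.
  by rewrite exprMn [(- s 1 1) ^+ n]exprNn exprVn; ring.
have [-> | d0] := eqVneq (s 1 1) 0.
  rewrite homog_eval_infty gn mul1r (homog_eval_div g_size) //= => _.
  by rewrite exprMn [(- s 0 1) ^+ n]exprNn exprVn invfM; ring.
rewrite !(homog_eval_div g_size) //= => _.
by rewrite exprMn [(- s 1 1) ^+ n]exprNn exprVn invfM; ring.
Qed.

Lemma mx2_act_div s (v : K * K) : v.2 != 0 ->
  mx2_act s (v.1 / v.2, 1)
    = (v.2^-1 * (mx2_act s v).1, v.2^-1 * (mx2_act s v).2).
Proof. by move=> v2; rewrite /mx2_act /=; congr pair; field. Qed.

Lemma mobius_act s x : mobius s (Some x) =
  let w := mx2_act s (x, 1) in if w.2 != 0 then Some (w.1 / w.2) else None.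
Proof. by rewrite /mobius /mx2_act /= !mulr1. Qed.

End MobiusAction.

(** * Invariance of the root set under the matrices M *)

Section RootInvariance.

Variables (F : fieldType) (L : fieldType) (iota : {rmorphism F -> L}).
Local Notation "p ^i" := (map_poly iota p) (at level 2, format "p ^i").
Implicit Types (f g p : {poly F}) (s : 'M[F]_2) (x y : L).

Lemma map_mob_poly s p : (mob_poly s p)^i = mob_poly (map_mx iota s) p^i.
Proof.
rewrite /mob_poly size_map_poly rmorph_sum /=; apply: eq_bigr => i _.
rewrite coef_map !mxE linearZ /= rmorphM !rmorphXn !rmorphD /= !linearZ /=.
by rewrite !map_polyX !map_polyC.
Qed.

(** The factorization [s diag(z, 1) adj(s)] of the matrix, read on vectors. *)
Lemma M_mx_actE s z v : let s' := map_mx iota s in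
  mx2_act (M_mx iota s z) v =
  mx2_act s' (z * (s' 1 1 * v.1 - s' 0 1 * v.2), s' 0 0 * v.2 - s' 1 0 * v.1).
Proof. by rewrite /mx2_act !mxE /=; congr pair; ring. Qed.

Lemma M_mx_actV s z v : z != 0 ->
  mx2_act (M_mx iota s z) (mx2_act (M_mx iota s z^-1) v)
    = (iota (\det s) ^+ 2 * v.1, iota (\det s) ^+ 2 * v.2).
Proof.
move=> z0; rewrite /mx2_act det_mx2E !mxE /= rmorphB !rmorphM /=.
by congr pair; field.
Qed.

Lemma det_M_mx s z : \det (M_mx iota s z) = z * iota (\det s) ^+ 2.
Proof. by rewrite !det_mx2E !mxE /= rmorphB !rmorphM /=; ring. Qed.

(** By [M_mx_actE] the left side is [mob_poly s g] at [diag(z, 1) adj(s) v]. The hypothesis removes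
    [diag(z, 1)], and [s adj(s)] is the scalar [\det s], which comes out by homogeneity. *)
Lemma homog_eval_M_mx N s g z v : size g = N.+1 -> size (mob_poly s g) = N.+1 ->
    (forall w, homog_eval N (mob_poly s g)^i (z * w.1, w.2)
               = homog_eval N (mob_poly s g)^i w) ->
  homog_eval N g^i (mx2_act (M_mx iota s z) v)
    = iota (\det s) ^+ N * homog_eval N g^i v.
Proof.
move=> g_size m_size m_inv.
rewrite M_mx_actE; set s' := map_mx iota s.
have mob_s' w :
    homog_eval N g^i (mx2_act s' w) = homog_eval N (mob_poly s g)^i w.
  by rewrite map_mob_poly homog_eval_mob -?map_mob_poly ?size_map_poly.
set u := (s' 1 1 * v.1 - s' 0 1 * v.2, s' 0 0 * v.2 - s' 1 0 * v.1).
rewrite -[(z * _, _)]/(z * u.1, u.2) mob_s' m_inv -mob_s' -homog_evalZ.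
congr homog_eval; rewrite /mx2_act det_mx2E /u /s' !mxE /= rmorphB !rmorphM /=.
by congr pair; ring.
Qed.

Lemma M_mx_unit s z : s \in unitmx -> z != 0 -> M_mx iota s z \in unitmx.
Proof.
rewrite !unitmxE det_M_mx !unitfE => det_neq0 z_neq0.
by rewrite mulf_neq0 // expf_neq0 // fmorph_eq0.
Qed.

Lemma M_mx_invariant N s g z : s \in unitmx -> z != 0 -> size g = N.+1 ->
    size (mob_poly s g) = N.+1 ->
    (forall w, homog_eval N (mob_poly s g)^i (z * w.1, w.2)
               = homog_eval N (mob_poly s g)^i w) ->
  mobius_invariant (M_mx iota s z) (is_root iota g).
Proof.
move=> sU z_neq0 g_size m_size m_inv.
have root_act x t : t != 0 ->
    (forall w, homog_eval N (mob_poly s g)^i (t * w.1, w.2)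
               = homog_eval N (mob_poly s g)^i w) ->
    root g^i x -> let w := mx2_act (M_mx iota s t) (x, 1) in
    w.2 != 0 /\ root g^i (w.1 / w.2).
  move=> t_neq0 t_inv gx; apply: (@homog_eval_root _ N).
  - by rewrite size_map_poly.
  - by rewrite mx2_act_neq0 ?M_mx_unit // -pair_eqE negb_and oner_neq0 orbT.
  by rewrite homog_eval_M_mx // homog_eval1 ?size_map_poly // (rootP gx) mulr0.
move=> b; split=> [[[x|] gx <-]|] //.
  by rewrite mobius_act; have [/= -> ?] := root_act x z z_neq0 m_inv gx.
case: b => [y|] //= gy.
have zV_inv w : homog_eval N (mob_poly s g)^i (z^-1 * w.1, w.2)
                = homog_eval N (mob_poly s g)^i w.
  by rewrite -(m_inv (_, _)) /= mulVKf //; case: w.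
have zV_neq0 : z^-1 != 0 by rewrite invr_eq0.
have := root_act y _ zV_neq0 zV_inv gy.
have := M_mx_actV s (y, 1) z_neq0.
move: (mx2_act (M_mx iota s z^-1) _) => w /= Mw [w2 gw].
(* The preimage of [y] is its image under the matrix for [z^-1]: the product of the two matrices is
   the scalar [(\det s) ^+ 2]. *)
exists (Some (w.1 / w.2)) => //; rewrite mobius_act.
rewrite mx2_act_div // Mw /= mulr1.
have det_neq0 : iota (\det s) != 0 by rewrite fmorph_eq0 -unitfE -unitmxE.
rewrite mulf_neq0 ?invr_eq0 ?expf_neq0 //; congr (Some _); field.
by rewrite w2 det_neq0.
Qed.

End RootInvariance.

(** * Moebius substitutions: inversion and irreducibility *)

Section MobiusTransforms.

Variables (F : finFieldType) (L : closedFieldType) (iota : {rmorphism F -> L}).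
Local Notation q := #|F|.
Local Notation "p ^i" := (map_poly iota p) (at level 2, format "p ^i").
Implicit Types (f g p : {poly F}) (s : 'M[F]_2) (x y : L).

(** The identity is checked by values in the closed field [L], where every nonzero polynomial has a
    non-root; values in the finite field [F] would not determine a polynomial. *)
Lemma mob_polyK N s s' p : s' *m s = 1%:M -> size p = N.+1 ->
  size (mob_poly s' p) = N.+1 -> mob_poly s (mob_poly s' p) = p.
Proof.
move=> ss' p_size m_size; apply: (map_poly_inj iota).
apply/eqP; rewrite -subr_eq0; apply/closed_nonrootP => -[x].
rewrite rootE hornerD hornerN !map_mob_poly (@horner_mob_poly _ N); last first.
  by rewrite -map_mob_poly size_map_poly.
rewrite homog_eval_mob -?map_mob_poly ?size_map_poly // -mx2_actM -map_mxM ss'.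
by rewrite map_mx1 mx2_act1 homog_eval1 ?size_map_poly // subrr eqxx.
Qed.

Hypothesis Lalg : forall x, algebraicOver iota x.

(** A root [x] of the transform is moved by [s] to a root of [f]. As [s] has entries in [F], this
    root is fixed by the powers of Frobenius that fix [x], so [irredp_root_degree] bounds [k]
    below. *)
Lemma irredp_mob_poly N s f : s \in unitmx -> irreducible_poly f ->
  size f = N.+1 -> size (mob_poly s f) = N.+1 -> irreducible_poly (mob_poly s f).
Proof.
move=> sU f_irr f_size m_size; apply: (irredp_criterion Lalg).
  by rewrite m_size -f_size f_irr.1.
move=> x k; rewrite map_mob_poly => /rootP.
rewrite (@horner_mob_poly _ N) ?size_map_poly // => root0 k_gt0 xk.
have w_neq0 : mx2_act (map_mx iota s) (x, 1) != 0.
  by rewrite mx2_act_neq0 ?map_unitmx // -pair_eqE negb_and oner_neq0 orbT.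
have [|w2 fw] := homog_eval_root _ w_neq0 root0.
  by rewrite size_map_poly.
rewrite m_size ltnS; apply: (irredp_root_degree f_irr f_size fw k_gt0).
have iotak c : iota c ^+ (q ^ k) = iota c by rewrite -rmorphXn expf_card_pow.
rewrite /mx2_act /= !mxE expr_div_n !(exprD_card iota) !exprMn.
by rewrite !iotak xk expr1n.
Qed.

End MobiusTransforms.

(** * Order in the projective linear group *)

Section ProjectiveOrder.

Lemma mx2M (R : comNzRingType) (a b c d a' b' c' d' : R) :
  mx2 a b c d *m mx2 a' b' c' d'
    = mx2 (a * a' + b * c') (a * b' + b * d') (c * a' + d * c') (c * b' + d * d').
Proof.
apply/matrixP => i j; rewrite !mxE !big_ord_recl big_ord0 addr0 !mxE /=.
by case: (i == ord0); case: (j == ord0).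
Qed.

Lemma mx2_id (R : nzRingType) : mx2 1 0 0 1 = 1%:M :> 'M[R]_2.
Proof. by apply/matrixP => -[[|[|[]]] //= ?] [[|[|[]]] //= ?]; rewrite !mxE. Qed.

Variable K : finFieldType.
Implicit Types (s : 'M[K]_2) (z : K).

Local Notation Z := 'Z('GL_2[K])%g.

Lemma mem_centerGL (u : {'GL_2[K]}) :
  reflect (forall v : {'GL_2[K]}, u *m v = v *m u) (u \in Z)%g.
Proof.
apply: (iffP idP) => [/centerP[_ uC] v | uC].
  by have /(congr1 val) := uC v (in_setT v).
by apply/centerP; split=> [|v _]; [rewrite inE | apply/val_inj/uC].
Qed.

Lemma diag_center z k (u : {'GL_2[K]}) :
  GLval u = mx2 z 0 0 1 -> ((u ^+ k)%g \in Z) = (z ^+ k == 1).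
Proof.
move=> uE.
have ukE : GLval (u ^+ k)%g = mx2 (z ^+ k) 0 0 1.
  elim: k => [|k IH]; first by rewrite expg0 expr0 mx2_id.
  rewrite expgS exprS GL_MxE uE IH mx2M.
  by rewrite !mul0r !mulr0 !addr0 !add0r mulr1.
apply/mem_centerGL/eqP => [uC | zk1 v]; last first.
  by rewrite ukE zk1 mx2_id mul1mx mulmx1.
(* Commuting with this transvection forces [z ^+ k = 1], by comparison of the entries at
   [(0, 1)]. *)
have tU : mx2 1 1 0 1 \in (unitmx : {pred 'M[K]_2}).
  by rewrite unitmxE unitfE det_mx2E !mxE /= mulr1 mulr0 subr0 oner_neq0.
have := uC (Sub (mx2 1 1 0 1) tU); rewrite ukE /= mx2M mx2M.
move/matrixP/(_ 0 1); rewrite !mxE /=.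
by rewrite !(mulr1, mulr0, mul0r, addr0, add0r).
Qed.

(** Here [adj(s)] is written as [\det s] times [invmx s]. Multiplying by [s] on the right first
    avoids the entries of [invmx s]. *)
Lemma M_mx_factor s z : s \in unitmx ->
  M_mx idfun s z = (s *m mx2 z 0 0 1 *m invmx s) *m (\det s)%:M.
Proof.
move=> sU; have Ms : M_mx idfun s z *m s = s *m mx2 z 0 0 1 *m (\det s)%:M.
  have ord2 (i : 'I_2) : i = 0 \/ i = 1.
    by case: i => -[|[|[]]] //= ?; [left | right]; apply/val_inj.
  apply/matrixP => i j; rewrite !mulmx2E det_mx2E.
  by case: (ord2 i) => ->; case: (ord2 j) => ->; rewrite !mxE /=; ring.
by rewrite -[LHS](mulmxK sU) Ms -!mulmxA scalar_mxC.
Qed.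

(** Modulo the center [M] is conjugate to [diag(z, 1)], so by [diag_center] its [k]-th power is
    trivial exactly when [z ^+ k = 1]. *)
Lemma order_M_mx s z T (M : {'GL_2[K]}) : s \in unitmx ->
    GLval M = M_mx idfun s z -> (0 < T)%N -> T.-primitive_root z ->
  #[coset Z M]%g = T.
Proof.
move=> sU ME T_gt0 z_prim.
have z_neq0 : z != 0.
  apply: contra_eq_neq (prim_expr_order z_prim) => ->.
  by rewrite expr0n (gtn_eqF T_gt0) eq_sym oner_neq0.
have dU : mx2 z 0 0 1 \in (unitmx : {pred 'M[K]_2}).
  by rewrite unitmxE unitfE det_mx2E !mxE /= mulr1 mulr0 subr0.
have cU : (\det s)%:M \in (unitmx : {pred 'M[K]_2}).
  by rewrite unitmxE det_scalar unitrX // -unitmxE.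
pose S : {'GL_2[K]} := Sub s sU.
pose D : {'GL_2[K]} := Sub (mx2 z 0 0 1) dU.
pose C : {'GL_2[K]} := Sub (\det s)%:M cU.
have MdE : M = ((D ^ S^-1) * C)%g.
  apply/val_inj; rewrite [LHS]ME M_mx_factor // conjgE invgK mulgA.
  by rewrite /= .
have CZ : C \in Z by apply/mem_centerGL => v; rewrite scalar_mxC.
have nZ u : u \in 'N(Z)%g.
  by have /subsetP-> := normal_norm (center_normal 'GL_2[K]); rewrite ?inE.
have MZ k : (coset Z M ^+ k == 1)%g = (z ^+ k == 1).
  rewrite -morphX // -(@diag_center z k D) //.
  transitivity ((M ^+ k)%g \in Z).
    by apply/eqP/idP => [/(coset_idr (nZ _)) | /coset_id].
  rewrite MdE expgMn; last first.
    by have /centerP[_ /(_ (D ^ S^-1)%g)] := CZ; rewrite inE => /(_ isT).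
  by rewrite (groupMr _ (groupX k CZ)) -conjXg memJ_norm.
apply/eqP; rewrite eqn_dvd order_dvdn MZ (prim_expr_order z_prim) eqxx /=.
by rewrite (prim_order_dvd z_prim) -MZ expg_order.
Qed.

End ProjectiveOrder.

(** * Descent to a finite field and the iterated sequence *)

Lemma homog_eval_irredp (K : fieldType) N (p : {poly K}) v :
    irreducible_poly p -> size p = N.+1 -> v != 0 -> homog_eval N p v = 0 ->
  v.2 != 0 /\ p %= 'X - (v.1 / v.2)%:P.
Proof.
move=> p_irr p_size v_neq0 pv.
have [v2 root_p] := homog_eval_root p_size v_neq0 pv; split=> //.
by rewrite eqp_sym (apply_irredp p_irr) ?size_XsubC // dvdp_XsubCl.
Qed.

Lemma col0_neq0 (K : fieldType) (s : 'M[K]_2) :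
  s \in unitmx -> (s 0 0, s 1 0) != 0.
Proof.
move=> sU; have := mx2_act_neq0 sU (v := (1, 0)).
rewrite /mx2_act /= !mulr1 !mulr0 !addr0; apply.
by rewrite -pair_eqE negb_and oner_neq0.
Qed.

(** The matrix over [L] descends to a finite field [K] whose image contains that of [F] and [z], so
    its order can be computed in ['GL_2[K]] modulo the center. *)
Lemma M_mx_lift (F L : fieldType) (iota : {rmorphism F -> L}) (K : finFieldType)
    (j : {rmorphism K -> L}) (s : 'M[F]_2) (z : L) T :
    s \in unitmx -> (forall c, exists y, j y = iota c) -> (exists z0, j z0 = z) ->
    (0 < T)%N -> z != 0 ->
  exists M : {'GL_2[K]}, map_mx j (GLval M) = M_mx iota s z
    /\ (T.-primitive_root z -> #[coset 'Z('GL_2[K]) M]%g = T).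
Proof.
move=> sU j_surj [z0 jz0] T_gt0 z_neq0.
have j_const c : {y | j y == iota c}.
  by apply/sigW; have [y <-] := j_surj c; exists y.
have [s0 js0] : exists s0, map_mx j s0 = map_mx iota s.
  exists (\matrix_(k, l) sval (j_const (s k l))); apply/matrixP => k l.
  by rewrite !mxE; case: (j_const _) => y /= /eqP.
have s0U : s0 \in unitmx by rewrite -(map_unitmx j) js0 map_unitmx.
have jM : map_mx j (M_mx idfun s0 z0) = M_mx iota s z.
  have js k l : j (s0 k l) = iota (s k l).
    by have /matrixP/(_ k l) := js0; rewrite !mxE.
  apply/matrixP => k l; rewrite !mxE.
  by case: (k == ord0); case: (l == ord0);
    rewrite /= !(rmorphB, rmorphM, rmorph1) /= !js jz0.
have MU : M_mx idfun s0 z0 \in unitmx.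
  by rewrite -(map_unitmx j) jM M_mx_unit.
exists (Sub (M_mx idfun s0 z0) MU); split=> // z_prim.
apply: (order_M_mx s0U _ T_gt0) => //.
by rewrite -(fmorph_primitive_root j) jz0.
Qed.

Section Iteration.

Variables (F : finFieldType) (L : closedFieldType) (iota : {rmorphism F -> L}).
Hypothesis Lalg : forall x, algebraicOver iota x.
Variables (t n : nat) (sigma : 'M[F]_2) (g : {poly F}).
Hypothesis t_ge2 : (2 <= t)%N.
Hypothesis t_primes : forall l, prime l -> (l %| t)%N -> (l %| #|F| - 1)%N.
Hypothesis sigma_GL2 : sigma \in unitmx.
Hypothesis g_monic : g \is monic.
Hypothesis g_irr : irreducible_poly g.
Hypothesis g_deg : size g = n.+1.
Hypothesis g_pole : sigma 1 0 != 0 -> g != 'X - (sigma 0 0 / sigma 1 0)%:P.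
Hypothesis n_even : (#|F| %% 4 = 3)%N -> ~~ odd t -> ~~ odd n.
Hypothesis eta_nonpower : forall l, prime l -> (l %| t)%N ->
  ~ exists y : F, eta_sigma g sigma = y ^+ l.

Local Notation f := (mob_poly sigma g).

(** A drop in degree would mean that [g] vanishes at [(a, c)]. This point would then be affine, and
    irreducibility would make [g] equal to [X - a/c], against [g_pole]. *)
Lemma size_mob_g : size f = n.+1.
Proof.
apply: size_mob_poly => //; apply/eqP => g0.
have [c0] := homog_eval_irredp g_irr g_deg (col0_neq0 sigma_GL2) g0.
by rewrite eqp_monic ?monicXsubC // => /eqP g_eq; case/eqP: (g_pole c0).
Qed.

Lemma irredp_mob_g : irreducible_poly f.
Proof. exact: (irredp_mob_poly Lalg sigma_GL2 g_irr g_deg size_mob_g). Qed.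

(** The constant and top coefficients of [f] are the values of [g] at the images of 0 and infinity.
    This identifies eta with the norm in [irredp_root_norm]. *)
Lemma eta_sigma_mob : eta_sigma g sigma = (-1) ^+ n * f`_0 / f`_n.
Proof.
rewrite (eta_sigmaE sigma_GL2 g_monic g_deg) (coef_mob_poly _ g_deg).
rewrite -horner_coef0 (horner_mob_poly _ _ g_deg) /mx2_act /=.
by rewrite !mulr0 !mulr1 !add0r.
Qed.

(** An even [t] makes [q] odd; if [q] is 3 modulo 4, then [n] is even and [3 ^ 2] is 1 modulo 4. *)
Lemma card_expn_mod4 : ~~ odd t -> (#|F| ^ n = 1 %[mod 4])%N.
Proof.
move=> t_even; have q_gt1 := finNzRing_gt1 F.
have : (2 %| #|F| - 1)%N by apply: t_primes => //; rewrite dvdn2.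
rewrite dvdn2 oddB ?(ltnW q_gt1) // addbT negbK => q_odd.
have [q1|q3] : (#|F| %% 4 = 1 \/ #|F| %% 4 = 3)%N by lia.
  by rewrite -modnXm q1 exp1n.
rewrite -modnXm q3 -(even_halfK (n_even q3 t_even)) -mul2n expnM.
by rewrite -modnXm exp1n.
Qed.

Lemma irredp_mob_comp_Xn m : irreducible_poly (f \Po 'X^(t ^ m)).
Proof.
have tm_dvd l : prime l -> (l %| t ^ m)%N -> (l %| t)%N.
  by move=> l_pr; rewrite Euclid_dvdX // => /andP[].
apply: (irredp_comp_Xn Lalg irredp_mob_g size_mob_g).
- by rewrite expn_gt0 ltnW.
- by move=> l l_pr /(tm_dvd l l_pr); apply: t_primes.
- by rewrite oddX negb_or => /andP[_]; apply: card_expn_mod4.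
- move=> l l_pr /(tm_dvd l l_pr) lt; rewrite -eta_sigma_mob.
  exact: eta_nonpower.
(* For [m = 0] no prime divides [t ^ m], so a prime factor of [t] itself is used: a zero constant
   coefficient would make eta equal to 0, an [l]-th power. *)
apply/eqP => f0; apply: (eta_nonpower (pdiv_prime t_ge2) (pdiv_dvd t)).
by exists 0; rewrite eta_sigma_mob f0 mulr0 mul0r expr0n (gtn_eqF (pdiv_gt0 _)).
Qed.

(** The third clause drives the induction: [mob_poly sigma] cancels the outer
    [mob_poly (invmx sigma)] of each transform, so only the substitutions of ['X^t] accumulate. *)
Lemma R_iterP m : let gm := R_iter sigma t g m in
  [/\ irreducible_poly gm, size gm = (n * t ^ m).+1
    & mob_poly sigma gm = f \Po 'X^(t ^ m)].
Proof.
elim: m => [|m [gm_irr gm_size gm_mob]] /=.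
  by split; rewrite ?muln1 // expn0 expr1 comp_polyXr.
have n_gt0 : (0 < n)%N by have := g_irr.1; rewrite g_deg.
rewrite /= /R_transform gm_mob /subst_pow -comp_polyA comp_Xn_poly -exprM -expnS.
have {}h_size : size (f \Po 'X^(t ^ m.+1)) = (n * t ^ m.+1).+1.
  by rewrite (size_comp_Xn size_mob_g) // expn_gt0 ltnW.
have h_irr := irredp_mob_comp_Xn m.+1.
have sVU : invmx sigma \in unitmx by rewrite unitmx_inv.
have size_eq :
    size (mob_poly (invmx sigma) (f \Po 'X^(t ^ m.+1))) = (n * t ^ m.+1).+1.
  (* A zero at the image of infinity would make this irreducible polynomial linear, while its degree
     is a multiple of [t]. *)
  apply: size_mob_poly => //; apply/eqP => h0.
  have [_ /eqp_size] := homog_eval_irredp h_irr h_size (col0_neq0 sVU) h0.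
  rewrite h_size size_XsubC => -[] /eqP; rewrite muln_eq1 => /andP[_].
  by rewrite expnS muln_eq1 (gtn_eqF t_ge2).
split=> //; first exact: (irredp_mob_poly Lalg sVU h_irr h_size size_eq).
by apply: (mob_polyK iota _ h_size size_eq); rewrite mulVmx.
Qed.

End Iteration.

Theorem theorem1p2 (F : finFieldType) (L : closedFieldType)
    (iota : {rmorphism F -> L}) (Lalg : forall x : L, algebraicOver iota x)
    (t : nat) (t_ge2 : (2 <= t)%N)
    (t_primes : forall l : nat, prime l -> (l %| t)%N -> (l %| #|F| - 1)%N)
    (sigma : 'M[F]_2) (sigma_GL2 : sigma \in unitmx)
    (g : {poly F}) (n : nat) (g_monic : g \is monic)
    (g_irr : irreducible_poly g) (g_deg : size g = n.+1)
    (g_pole : sigma 1 0 != 0 -> g != 'X - (sigma 0 0 / sigma 1 0)%:P)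
    (n_even : (#|F| %% 4 = 3)%N -> ~~ odd t -> ~~ odd n)
    (eta_nonpower : forall l : nat, prime l -> (l %| t)%N ->
       ~ exists y : F, eta_sigma g sigma = y ^+ l) :
  (forall m : nat,
     irreducible_poly (R_iter sigma t g m)
     /\ size (R_iter sigma t g m) = (t ^ m * n).+1)
  /\
  (forall (m : nat) (zeta : L), zeta ^+ (t ^ m) = 1 ->
     mobius_invariant (M_mx iota sigma zeta) (is_root iota (R_iter sigma t g m))
     /\ exists M : {'GL_2[adjoin_root iota (t ^ m) zeta]},
          map_mx (@adjoin_root_inj F L iota (t ^ m) zeta) (GLval M)
            = M_mx iota sigma zeta
          /\ ((t ^ m).-primitive_root zeta ->
              #[coset 'Z('GL_2[adjoin_root iota (t ^ m) zeta]) M]%g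
                = (t ^ m)%N)).
Proof.
have iterP := R_iterP Lalg t_ge2 t_primes sigma_GL2 g_monic g_irr g_deg g_pole
  n_even eta_nonpower.
split=> [m | m z zT].
  by have [gm_irr gm_size _] := iterP m; rewrite mulnC.
have T_gt0 : (0 < t ^ m)%N by rewrite expn_gt0 ltnW.
have f_size := size_mob_g sigma_GL2 g_monic g_irr g_deg g_pole.
have z_neq0 : z != 0.
  apply: contra_eq_neq zT => ->.
  by rewrite expr0n (gtn_eqF T_gt0) eq_sym oner_neq0.
split.
  have [_ gm_size gm_mob] := iterP m.
  apply: (M_mx_invariant sigma_GL2 z_neq0 gm_size).
    by rewrite gm_mob (size_comp_Xn f_size T_gt0).
  move=> w; rewrite gm_mob map_comp_poly map_polyXn.
  by apply: homog_eval_comp_Xn; rewrite ?size_map_poly.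
(* The finite field is [F(zeta)]: its image consists of the values at [zeta] of polynomials over
   [F], with constants and ['X] giving [F] and [zeta]. *)
pose j : {rmorphism _ -> L} := @adjoin_root_inj F L iota (t ^ m) z.
have j_eval := adjoin_rootP iota T_gt0 zT.
apply: (M_mx_lift (j := j) sigma_GL2 _ _ T_gt0 z_neq0) => [c |].
  by apply/j_eval; exists c%:P; rewrite map_polyC hornerC.
by apply/j_eval; exists 'X; rewrite map_polyX hornerX.
Qed.
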